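(* Let $A=\{(x,y,z)\mid x,y,z\in\{0,1\}\}$. For every position $m\in M\setminus A$ of Triangle Game, $$g^+(m)=g^-(m).$$ Consequently, Triangle Game is tame.
   Context: $\mathbb{Z}_{\ge 0}$ is the set of non-negative integers. Triangle Game is the impartial game with set of positions $M=(\mathbb{Z}_{\ge 0})^3$, where the set of options (positions reachable in one move) of $(x,y,z)\in M$ is $$f((x,y,z))=\{(x-i,y+j,z)\mid 1\le i\le x,\ 0\le j<i\}\cup\{(x,y-i,z+j)\mid 1\le i\le y,\ 0\le j<i\}\cup\{(x+j,y,z-i)\mid 1\le i\le z,\ 0\le j<i\}$$ ($i,j$ integers). Each move strictly decreases the total $x+y+z$; the only terminal position (position with no options) is $(0,0,0)$. For a finite set $X\subset\mathbb{Z}_{\ge 0}$, $\mathrm{mex}(X)=\min(\mathbb{Z}_{\ge 0}\setminus X)$. The Sprague–Grundy value for normal play is defined recursively by $g^+(m)=\mathrm{mex}(\{g^+(m')\mid m'\in f(m)\})$ for all $m\in M$. The Sprague–Grundy value for misère play is defined recursively by $g^-(m)=1$ if $m$ is terminal, and $g^-(m)=\mathrm{mex}(\{g^-(m')\mid m'\in f(m)\})$ otherwise. A position $m$ is called an $(i,j)$-position if $g^+(m)=i$ and $g^-(m)=j$. An impartial ruleset is called tame if every position is a $(0,1)$-position, a $(1,0)$-position, or a $(k,k)$-position for some $k\in\mathbb{Z}_{\ge 0}$. *)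

(* Defs.v *)
From mathcomp Require Import all_boot.
From mathcomp Require Import zify.

Set Implicit Arguments.
Unset Strict Implicit.
Unset Printing Implicit Defensive.

Fact mex_subproof (X : seq nat) : exists n, n \notin X.
Proof.
exists (sumn X).+1; apply/negP => XX.
suff: (sumn X).+1 <= sumn X by rewrite ltnn.
move: (sumn X).+1 XX => n; elim: X => //= x X IH.
rewrite inE => /predU1P[-> | /IH le_nX]; first exact: leq_addr.
exact: leq_trans le_nX (leq_addl _ _).
Qed.

(* The finite set X is given by a list; order and repetitions are ignored. *)
Definition mex (X : seq nat) : nat := ex_minn (mex_subproof X).

(* Impartial rulesets in which every position has finitely many options and
   every sequence of moves is finite. *)
Record ruleset := Ruleset {
  position : eqType;
  options : position -> seq position;
  options_wf : well_founded (fun m' m => m' \in options m)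
}.

Definition terminal (G : ruleset) (m : position G) : bool :=
  options m == [::].

(* seq_sub_enum lists the options m' of m paired with a proof of
   m' \in options m, as required by well-founded recursion; the intended
   recursive equations are gplusE and gminusE. *)
Definition gplus (G : ruleset) : position G -> nat :=
  Fix (@options_wf G) (fun=> nat) (fun m g =>
    mex [seq g (ssval m') (ssvalP m') | m' <- seq_sub_enum (options m)]).

Definition gminus (G : ruleset) : position G -> nat :=
  Fix (@options_wf G) (fun=> nat) (fun m g =>
    if terminal m then 1
    else mex [seq g (ssval m') (ssvalP m') | m' <- seq_sub_enum (options m)]).

Lemma eq_mex (X Y : seq nat) : X =i Y -> mex X = mex Y.
Proof.
move=> eqXY; rewrite /mex; case: ex_minnP => m mX minX.
case: ex_minnP => n nY minY; apply/eqP; rewrite eqn_leq.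
by rewrite minX ?eqXY // minY -?eqXY.
Qed.

Lemma mem_map_seq_sub (T : eqType) (g : T -> nat) (s : seq T) :
  [seq g (ssval x) | x <- seq_sub_enum s] =i [seq g x | x <- s].
Proof.
move=> n; apply/mapP/mapP => [[x _ ->] | [x sx ->]].
  by exists (ssval x) => //; apply: ssvalP.
by exists (SeqSub sx) => //; apply: mem_seq_sub_enum.
Qed.

Lemma gplusE (G : ruleset) (m : position G) :
  gplus m = mex [seq gplus m' | m' <- options m].
Proof.
rewrite {1}/gplus Fix_eq => [|x f g eq_fg].
  exact/eq_mex/(mem_map_seq_sub (@gplus G)).
by congr mex; apply: eq_map => y; apply: eq_fg.
Qed.

Lemma gminusE (G : ruleset) (m : position G) :
  gminus m = if terminal m then 1 else mex [seq gminus m' | m' <- options m].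
Proof.
rewrite {1}/gminus Fix_eq => [|x f g eq_fg].
  by case: ifP => // _; apply/eq_mex/(mem_map_seq_sub (@gminus G)).
by case: ifP => // _; congr mex; apply: eq_map => y; apply: eq_fg.
Qed.

Definition ij_position (G : ruleset) (i j : nat) (m : position G) : Prop :=
  gplus m = i /\ gminus m = j.

Definition tame (G : ruleset) : Prop :=
  forall m : position G,
    [\/ ij_position 0 1 m, ij_position 1 0 m | exists k, ij_position k k m].

Definition triangle_options (m : nat * nat * nat) : seq (nat * nat * nat) :=
  let: (x, y, z) := m in
  [seq (x - i, y + j, z) | i <- iota 1 x, j <- iota 0 i] ++
  [seq (x, y - i, z + j) | i <- iota 1 y, j <- iota 0 i] ++
  [seq (x + j, y, z - i) | i <- iota 1 z, j <- iota 0 i].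

Lemma mem_triangle_options (x y z : nat) (m : nat * nat * nat) :
  reflect (exists i j, j < i /\
             [\/ i <= x /\ m = (x - i, y + j, z),
                 i <= y /\ m = (x, y - i, z + j)
               | i <= z /\ m = (x + j, y, z - i)])
          (m \in triangle_options (x, y, z)).
Proof.
rewrite /triangle_options !mem_cat; apply: (iffP or3P) => [|[i [j [ji]]]].
  by case=> /allpairsPdep[i [j [+ + ->]]]; rewrite !mem_iota add0n add1n ltnS
    => /andP[i0 ix] ji; exists i, j; split=> //;
    [apply: Or31 | apply: Or32 | apply: Or33].
have i0 : 0 < i by apply: leq_ltn_trans ji.
by case=> -[ix ->]; [apply: Or31 | apply: Or32 | apply: Or33];
  apply/allpairsPdep; exists i, j; rewrite !mem_iota add1n ltnS i0 ix ji.
Qed.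

Lemma triangle_options_lt (m m' : nat * nat * nat) :
  m' \in triangle_options m -> m'.1.1 + m'.1.2 + m'.2 < m.1.1 + m.1.2 + m.2.
Proof.
case: m => [[x y] z] /mem_triangle_options[i [j [ji]]].
by case=> -[ix ->] /=; lia.
Qed.

Lemma triangle_options_wf :
  well_founded (fun m' m => m' \in triangle_options m).
Proof.
move=> m; have [n] := ubnP (m.1.1 + m.1.2 + m.2).
elim: n m => [|n IH] m; first (rewrite ltn0; discriminate).
rewrite ltnS => le_mn.
constructor => m' /triangle_options_lt lt_m'm.
apply: IH; exact: leq_trans lt_m'm le_mn.
Qed.

Definition triangle_game : ruleset := Ruleset triangle_options_wf.

Lemma triangle_terminal (m : position triangle_game) :
  terminal m = (m == (0, 0, 0)).
Proof.
by case: m => [[[|x] [|y]] [|z]].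
Qed.

Definition A : pred (nat * nat * nat) :=
  [pred m | let: (x, y, z) := m in
            [&& x \in [:: 0; 1], y \in [:: 0; 1] & z \in [:: 0; 1]]].

(* Main.v *)
(* On A every move just removes a unit, so g+ and g- are the parity of the
   total and its complement, both with values in {0, 1}.  A position outside A
   with an option in A has exactly one coordinate x >= 2; replacing x by 0 and
   by 1 are both moves, and they lead to positions of A of opposite parities.
   Hence {0, 1} is contained in both sets of option values, so A contributes
   the same values to both mex's, and g+ = g- outside A by induction. *)
Require Import Defs.
From mathcomp Require Import all_boot.
From mathcomp Require Import zify.

Definition parity (m : nat * nat * nat) : bool := odd (m.1.1 + m.1.2 + m.2).

(** Nonemptiness matters for [b = false]: the mex of the empty list is 0, not 1. *)
Lemma mex_constant (b : bool) (X : seq nat) :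
  X != [::] -> {in X, forall n, n = b :> nat} -> mex X = ~~ b.
Proof.
case: X => // n X _ Xb.
have nb : n = b by apply: Xb; rewrite mem_head.
have bX : (b : nat) \in n :: X by rewrite nb mem_head.
rewrite /mex; case: ex_minnP => k kX mink.
have nbX : (~~ b : nat) \notin n :: X by apply/negP => /Xb; case: (b).
have := mink _ nbX; have : k != b by apply: contraNneq kX => ->.
by case: (b) => /=; lia.
Qed.

Lemma A_cases (x y z : nat) : ((x, y, z) \in A) = [&& x < 2, y < 2 & z < 2].
Proof. by rewrite inE /= !inE; lia. Qed.

(** With all coordinates at most 1, [j < i <= 1] forces [i = 1] and [j = 0]. *)
Lemma triangle_options_A (m m' : nat * nat * nat) :
  m \in A -> m' \in triangle_options m ->
  m' \in A /\ parity m' = ~~ parity m.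
Proof.
case: m => [[x y] z]; rewrite A_cases => /and3P[x2 y2 z2].
case/mem_triangle_options => i [j [ji]].
by case=> -[le_i ->]; rewrite A_cases /parity /=; lia.
Qed.

Lemma triangle_values_A (m : position triangle_game) :
  m \in A -> gplus m = parity m /\ gminus m = ~~ parity m.
Proof.
elim/(well_founded_ind triangle_options_wf): m => m IH mA.
have optA m' : m' \in triangle_options m ->
    gplus (m' : position triangle_game) = ~~ parity m /\
    gminus (m' : position triangle_game) = parity m.
  move=> m'm; have [m'A par] := triangle_options_A m m' mA m'm.
  by have := IH m' m'm m'A; rewrite par negbK.
rewrite gplusE gminusE; case: ifPn => [|nterm].
  rewrite triangle_terminal => /eqP->; split=> //.
  by rewrite /mex; case: ex_minnP => k _ /(_ 0 isT); case: k.
have nnil (g : position triangle_game -> nat) :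
    [seq g m' | m' <- triangle_options m] != [::].
  by move: nterm; rewrite /terminal /=; case: (triangle_options m).
split; last first.
  by apply: mex_constant => // n /mapP[m' /optA[_ ->] ->].
rewrite -[parity m in RHS]negbK.
by apply: mex_constant => // n /mapP[m' /optA[-> _] ->].
Qed.

Lemma triangle_options_both_parities (m m' : nat * nat * nat) (b : bool) :
  m \notin A -> m' \in triangle_options m -> m' \in A ->
  exists2 m'', m'' \in triangle_options m & m'' \in A /\ parity m'' = b.
Proof.
case: m => [[x y] z]; rewrite A_cases => mA.
case/mem_triangle_options => i [j [ji]].
(* The move lowers no coordinate but one, so the other two were below 2 before it; as [m] is outside
   [A], the lowered one was at least 2. *)
case=> -[le_i ->]; rewrite A_cases => /and3P[x2 y2 z2].
(* The bit [c] gives [(c, y, z)] parity [b]; since [c < 2 <= x], it is reached by removing [x - c]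
   from [x] with [j = 0]. *)
- pose c : nat := b (+) odd (y + z).
  exists (c, y, z); last by rewrite A_cases /parity /= /c; lia.
  apply/mem_triangle_options; exists (x - c), 0.
  split; first by rewrite /c; lia.
  by apply: Or31; split; [lia | congr (_, _, _); rewrite /c; lia].
- pose c : nat := b (+) odd (x + z).
  exists (x, c, z); last by rewrite A_cases /parity /= /c; lia.
  apply/mem_triangle_options; exists (y - c), 0.
  split; first by rewrite /c; lia.
  by apply: Or32; split; [lia | congr (_, _, _); rewrite /c; lia].
- pose c : nat := b (+) odd (x + y).
  exists (x, y, c); last by rewrite A_cases /parity /= /c; lia.
  apply/mem_triangle_options; exists (z - c), 0.
  split; first by rewrite /c; lia.
  by apply: Or33; split; [lia | congr (_, _, _); rewrite /c; lia].
Qed.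

Lemma triangle_gplus_gminus (m : position triangle_game) :
  m \notin A -> gplus m = gminus m.
Proof.
elim/(well_founded_ind triangle_options_wf): m => m IH mA.
rewrite gplusE gminusE ifN; last first.
  by rewrite triangle_terminal; apply: contraNneq mA => ->.
apply: eq_mex => n; apply/mapP/mapP => -[m' m'm ->].
- have [m'A | m'A] := boolP (m' \in A); last by exists m'; rewrite ?IH.
  (* On [A] the two values are complementary bits, so an option in [A] of parity opposite to [m']
     has as [gminus] exactly [gplus m']. The converse inclusion exchanges the two functions. *)
  have [m'' m''m [m''A par]] :=
    triangle_options_both_parities m m' (~~ parity m') mA m'm m'A.
  exists m'' => //.
  by rewrite (triangle_values_A m' m'A).1 (triangle_values_A m'' m''A).2 par negbK.
- have [m'A | m'A] := boolP (m' \in A); last by exists m'; rewrite ?IH.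
  have [m'' m''m [m''A par]] :=
    triangle_options_both_parities m m' (~~ parity m') mA m'm m'A.
  exists m'' => //.
  by rewrite (triangle_values_A m' m'A).2 (triangle_values_A m'' m''A).1 par.
Qed.

Theorem theorem2p10 :
  (forall m : position triangle_game, m \notin A -> gplus m = gminus m) /\
  tame triangle_game.
Proof.
split=> [|m]; first exact: triangle_gplus_gminus.
have [/triangle_values_A[gp gm] | mA] := boolP (m \in A).
  by case: (parity m) gp gm => gp gm; [apply: Or32 | apply: Or31].
by apply: Or33; exists (gplus m); split; rewrite // triangle_gplus_gminus.
Qed.
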